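(* Let $d\in\mathbb R_{++}^n$ and $P\subseteq\mathbb R^n$, and let $M_d(P):=\bigcup_{y\in P}\{x\in\mathbb R^n\,|\,x\prec_d y\}$. Then: (i) if there is $c\in\mathbb R$ with $\mathbf 1^Tx=c$ for all $x\in P$, then $M_d(P)$ is star-shaped with respect to $\frac{c}{\mathbf 1^Td}d$; (ii) if $P$ is convex, then $M_d(P)$ is path-connected; (iii) if $P$ is compact, then $M_d(P)$ is compact.
   Context: $\mathbf 1=(1,\ldots,1)^T$. A matrix $A\in\mathbb R^{n\times n}$ is $d$-stochastic if all its entries are nonnegative, $\mathbf 1^TA=\mathbf 1^T$ and $Ad=d$; $x\prec_d y$ means $x=Ay$ for some $d$-stochastic $A$. *)

(* Defs.v *)
From mathcomp Require Import all_boot all_order all_algebra.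
From mathcomp Require Import all_classical all_reals all_analysis.
Import Order.TTheory GRing.Theory Num.Theory.
Import numFieldNormedType.Exports.

Set Implicit Arguments.
Unset Strict Implicit.
Unset Printing Implicit Defensive.

Local Open Scope classical_set_scope.
Local Open Scope ring_scope.

Definition ones (R : realType) (n : nat) : 'cV[R]_n := const_mx 1.

(* The 1 x 1 matrix ones^T *m x, read as a scalar. *)
Definition ones_dot (R : realType) (n : nat) (x : 'cV[R]_n) : R :=
  ((ones R n)^T *m x) ord0 ord0.

Definition d_stochastic (R : realType) (n : nat) (d : 'cV[R]_n) (A : 'M[R]_n)
    : Prop :=
  [/\ forall i j, 0 <= A i j, (ones R n)^T *m A = (ones R n)^T & A *m d = d].

Definition d_majorized (R : realType) (n : nat) (d x y : 'cV[R]_n) : Prop :=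
  exists2 A : 'M[R]_n, d_stochastic d A & x = A *m y.

Definition Md (R : realType) (n : nat) (d : 'cV[R]_n) (P : set 'cV[R]_n)
    : set 'cV[R]_n :=
  \bigcup_(y in P) [set x | d_majorized d x y].

(* For nonempty S this forces S p (take t = 0); the empty set is star-shaped
   with respect to every point. *)
Definition star_shaped (R : realType) (V : lmodType R) (S : set V) (p : V)
    : Prop :=
  forall x, S x -> forall t : R, 0 <= t <= 1 -> S ((1 - t) *: p + t *: x).

(* The empty set is path-connected. *)
Definition path_connected (R : realType) (T : topologicalType) (S : set T)
    : Prop :=
  forall x y, S x -> S y ->
    exists g : R -> T,
      [/\ {within `[0, 1], continuous g}, g 0 = x, g 1 = y
        & g @` `[0, 1] `<=` S].
Arguments path_connected R {T} S.

(* Main.v *)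
(* Everything rests on the set of d-stochastic matrices being convex and
   compact. For (i), the matrix d 1^T / 1^T d is d-stochastic and sends every
   vector of P to c d / 1^T d, so the segment from there to A y is obtained by
   moving A. For (ii), A y and B z are joined by moving A to B and y to z
   simultaneously along segments. For (iii), M_d(P) is the image of a compact
   product under the continuous map (A, y) |-> A y. *)
Require Import Defs.
From mathcomp Require Import all_boot all_order all_algebra.
From mathcomp Require Import all_classical all_reals all_analysis.
Import Order.TTheory GRing.Theory Num.Theory.
Import numFieldNormedType.Exports.

Set Implicit Arguments.
Unset Strict Implicit.
Unset Printing Implicit Defensive.

Local Open Scope classical_set_scope.
Local Open Scope ring_scope.

(** A neighbourhood of [M] contains a product of neighbourhoods of its finitely many entries, and a
    filter is closed under finite intersections. *)
Lemma cvg_mxP (T : topologicalType) m n (U : Type) (F : set_system U)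
    (f : U -> 'M[T]_(m, n)) (M : 'M[T]_(m, n)) : Filter F ->
  (forall i j, f x i j @[x --> F] --> M i j) -> f @ F --> M.
Proof.
move=> FF fM A [P PM sPA]; apply: (@filterS _ F FF _ _ (fun x => sPA (f x))).
apply: filter_forall => i; apply: filter_forall => j.
exact: fM (PM i j).
Qed.

(** Each entry of the product is a finite sum of products of coordinates. An arbitrary filter lets
    this serve the linear constraints, the path in (ii) and the map in (iii). *)
Lemma cvg_mulmx (R : realType) m n p (U : Type) (F : set_system U)
    (f : U -> 'M[R]_(m, n)) (g : U -> 'M[R]_(n, p)) (A : 'M[R]_(m, n))
    (B : 'M[R]_(n, p)) : Filter F ->
  f @ F --> A -> g @ F --> B -> f x *m g x @[x --> F] --> A *m B.
Proof.
move=> FF fA gB; apply: cvg_mxP => i j; rewrite mxE.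
under eq_fun do rewrite mxE.
apply: (cvg_big add_continuous) => k _; apply: cvgM.
- exact: (cvg_comp _ _ fA (@coord_continuous R _ _ i k A)).
- exact: (cvg_comp _ _ gB (@coord_continuous R _ _ k j B)).
Qed.

(** Tychonoff for row vectors, transported along the continuous reshaping [vec_mx]. *)
Lemma mx_box_compact (R : realType) m n (a b : R) :
  compact [set A : 'M[R]_(m, n) | forall i j, a <= A i j <= b].
Proof.
have -> : [set A : 'M[R]_(m, n) | forall i j, a <= A i j <= b] =
    vec_mx @` [set v : 'rV[R]_(m * n) | forall k, a <= v ord0 k <= b].
  apply/seteqP; split => [A Aab|_ [v vab <-] i j]; last first.
    by rewrite mxE; exact: vab.
  exists (mxvec A); last exact: mxvecK.
  by move=> k; case/mxvec_indexP: k => i j; rewrite mxvecE; exact: Aab.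
apply: continuous_compact; last first.
  apply: (@rV_compact R _ (fun=> [set x | a <= x <= b])) => _.
  by rewrite -set_itvcc; exact: segment_compact.
apply: continuous_subspaceT => v; apply: (@cvg_mxP _ _ _ _ (nbhs v)) => i j; rewrite mxE.
by under eq_fun do rewrite mxE; exact: coord_continuous.
Qed.

Lemma ones_dotE (R : realType) n (x : 'cV[R]_n) :
  ones_dot x = \sum_i x i ord0.
Proof. by rewrite /ones_dot mxE; apply: eq_bigr => i _; rewrite !mxE mul1r. Qed.

Lemma ones_mulmx (R : realType) n (x : 'cV[R]_n) :
  (ones R n)^T *m x = (ones_dot x)%:M.
Proof. exact: mx11_scalar. Qed.

Lemma d_stochastic_conv (R : realType) n (d : 'cV[R]_n) (A B : 'M[R]_n) (t : R) :
  0 <= t <= 1 -> d_stochastic d A -> d_stochastic d B ->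
  d_stochastic d ((1 - t) *: A + t *: B).
Proof.
move=> /andP[t0 t1] [A0 A1 Ad] [B0 B1 Bd]; split.
- by move=> i j; rewrite !mxE addr_ge0 ?mulr_ge0 ?subr_ge0.
- by rewrite mulmxDr -!scalemxAr A1 B1 -scalerDl subrK scale1r.
- by rewrite mulmxDl -!scalemxAl Ad Bd -scalerDl subrK scale1r.
Qed.

Lemma ones_dot_gt0 (R : realType) n (d : 'cV[R]_n) :
  (forall i, 0 < d i ord0) -> (0 < n)%N -> 0 < ones_dot d.
Proof.
move=> d_gt0; case: n d d_gt0 => // n d d_gt0 _.
rewrite ones_dotE big_ord_recl ltr_pwDl // sumr_ge0 // => i _.
exact: ltW.
Qed.

Lemma d_stochastic_rank1 (R : realType) n (d : 'cV[R]_n) :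
  (forall i, 0 < d i ord0) ->
  d_stochastic d ((ones_dot d)^-1 *: (d *m (ones R n)^T)).
Proof.
move=> d_gt0; case: (posnP n) => [n0|n_gt0].
  (* In dimension 0 the sum [ones_dot d] is 0 and cannot be inverted, but all conditions concern
     empty matrices. *)
  by subst n; split; [case | rewrite !thinmx0 | rewrite !flatmx0].
have s_gt0 := ones_dot_gt0 d_gt0 n_gt0; split.
- move=> i j; rewrite !mxE big_ord1 !mxE mulr1.
  by rewrite mulr_ge0 ?invr_ge0 ?(ltW s_gt0) ?(ltW (d_gt0 _)).
- rewrite -scalemxAr mulmxA ones_mulmx mul_scalar_mx scalerA.
  by rewrite mulVf ?gt_eqF // scale1r.
- rewrite -scalemxAl -mulmxA ones_mulmx mul_mx_scalar scalerA.
  by rewrite mulVf ?gt_eqF // scale1r.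
Qed.

(** Column [j] sums to 1 and its remaining entries are nonnegative. *)
Lemma d_stochastic_le1 (R : realType) n (d : 'cV[R]_n) (A : 'M[R]_n) i j :
  d_stochastic d A -> A i j <= 1.
Proof.
move=> [A0 /rowP/(_ j) A1 _].
have <- : \sum_k A k j = 1.
  by move: A1; rewrite !mxE => <-; apply: eq_bigr => k _; rewrite !mxE mul1r.
by rewrite (bigD1 i) //= lerDl sumr_ge0.
Qed.

(** The set is cut out of the compact box of matrices with entries in [[0, 1]] by two linear
    equations, each the preimage of a closed singleton under a continuous map. *)
Lemma d_stochastic_compact (R : realType) n (d : 'cV[R]_n) :
  compact [set A | d_stochastic d A].
Proof.
have closed_mx1 m p (M : 'M[R]_(m, p)) : closed [set M].
  by apply: accessible_closed_set1; apply/hausdorff_accessible/norm_hausdorff.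
have -> : [set A | d_stochastic d A] =
    [set A : 'M[R]_n | forall i j, 0 <= A i j <= 1] `&`
    ((mulmx (ones R n)^T @^-1` [set (ones R n)^T]) `&` (mulmxr d @^-1` [set d])).
  apply/seteqP; split => A; last first.
    move=> [A01 [A1 Ad]]; split=> // i j.
    by have /andP[] := A01 i j.
  move=> sA; have [A0 A1 Ad] := sA; split=> // i j.
  by rewrite A0 (d_stochastic_le1 _ _ sA).
apply: compact_closedI; first exact: mx_box_compact.
apply: closedI; apply: preimage_closed => // A _.
- by apply: (@cvg_mulmx _ _ _ _ _ (nbhs A)); [exact: cvg_cst | exact: cvg_id].
- by apply: (@cvg_mulmx _ _ _ _ _ (nbhs A)); [exact: cvg_id | exact: cvg_cst].
Qed.

Theorem theorem4p11 (R : realType) (n : nat) (d : 'cV[R]_n)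
    (P : set 'cV[R]_n) (d_gt0 : forall i, 0 < d i ord0) :
  [/\ forall c : R, (forall x, P x -> ones_dot x = c) ->
        star_shaped (Md d P) ((c / ones_dot d) *: d),
      convex_set P -> path_connected R (Md d P)
    & compact P -> compact (Md d P)].
Proof.
split.
- move=> c Pc _ [y Py [A sA ->]] t t01; exists y => //.
  exists ((1 - t) *: ((ones_dot d)^-1 *: (d *m (ones R n)^T)) + t *: A).
    exact: d_stochastic_conv (d_stochastic_rank1 d_gt0) sA.
  (* Reassociating the rank-one term exposes [ones^T *m y], which is the scalar [c] because [y] lies
     in [P]. *)
  rewrite mulmxDl -!scalemxAl -mulmxA ones_mulmx (Pc y Py) mul_mx_scalar.
  by rewrite (scalerA (ones_dot d)^-1 c) (mulrC _ c).
- move=> cP _ _ [y Py [A sA ->]] [z Pz [B sB ->]].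
  (* The path is quadratic in [t], not a segment: [Md d P] itself need not be convex. *)
  exists (fun t => ((1 - t) *: A + t *: B) *m ((1 - t) *: y + t *: z)); split.
  + apply: continuous_subspaceT => t; apply: cvg_mulmx; apply: cvgD;
      apply: cvgZr_tmp; try exact: cvg_id;
      apply: cvgB; exact: cvg_cst || exact: cvg_id.
  + by rewrite subr0 !scale0r !scale1r !addr0.
  + by rewrite subrr !scale0r !scale1r !add0r.
  + move=> _ [t + <-]; rewrite /= in_itv /= => t01.
    exists ((1 - t) *: y + t *: z).
      have /andP[t0 t1] := t01.
      (* The convex combination puts the weight [t] on its first argument, hence [z] before [y]. *)
      have := cP z y (Itv01 t0 t1) (mem_set Pz) (mem_set Py).
      by rewrite addrC => /set_mem.
    by exists ((1 - t) *: A + t *: B) => //; exact: d_stochastic_conv.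
- move=> Pco.
  have -> : Md d P =
      (fun p => p.1 *m p.2) @` ([set A | d_stochastic d A] `*` P).
    apply/seteqP; split => [_ [y Py [A sA ->]]|_ [[A y] [/= sA Py] <-]].
      by exists (A, y).
    by exists y => //; exists A.
  apply: continuous_compact; last first.
    by apply: compact_setX => //; exact: d_stochastic_compact.
  apply: continuous_subspaceT => p.
  by apply: cvg_mulmx; [exact: cvg_fst | exact: cvg_snd].
Qed.
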